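(* No complemented subspace of a $C(K)$ space, where $K$ is a compact Hausdorff space (or, more generally, no complemented subspace of an M-space), is a Gurariĭ space.
   Context: All Banach spaces are real. $C(K)$ is the space of continuous real functions on $K$ with the supremum norm. An M-space is a Banach lattice in which $\|x\vee y\|=\max\{\|x\|,\|y\|\}$ for all $x,y\geq 0$. A closed subspace $Y$ of a Banach space $X$ is complemented if there is a bounded linear projection of $X$ onto $Y$. For $\varepsilon>0$, a linear operator $f\colon X\to Y$ between Banach spaces is an $\varepsilon$-isometric embedding if $(1+\varepsilon)^{-1}\|x\|\leq\|f(x)\|\leq(1+\varepsilon)\|x\|$ for every $x\in X\setminus\{0\}$; isometric embeddings are always linear. A Banach space $X$ is Gurariĭ if for every pair of finite-dimensional Banach spaces $S\subseteq T$, every isometric embedding $f\colon S\to X$ and every $\varepsilon>0$, there exists an $\varepsilon$-isometric embedding $g\colon T\to X$ with $g\restriction S=f$. *)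

(* Defs.v *)
From HB Require Import structures.
From mathcomp Require Import all_boot all_order all_algebra ring.
From mathcomp Require Import all_classical all_reals all_analysis.

Set Implicit Arguments.
Unset Strict Implicit.
Unset Printing Implicit Defensive.

Import Order.TTheory GRing.Theory Num.Theory.
Import numFieldNormedType.Exports.

Local Open Scope classical_set_scope.
Local Open Scope ring_scope.

Record closedSubspace (R : realType) (X : completeNormedModType R) :=
  ClosedSubspace {
    csset :> set X;
    csset0 : csset 0;
    cssetP : forall (a : R) (x y : X), csset x -> csset y -> csset (a *: x + y);
    csset_closed : closed csset }.

Section SubspaceType.
Variables (R : realType) (X : completeNormedModType R) (Y : closedSubspace X).

Definition cspred : {pred X} := fun x => x \in (Y : set X).

Lemma cspred_submod_closed : submod_closed cspred.
Proof.
split=> [|a x y]; rewrite /cspred !unfold_in !inE; first exact: csset0.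
exact: cssetP.
Qed.

HB.instance Definition _ :=
  GRing.isSubmodClosed.Build R X cspred cspred_submod_closed.

Record subspaceType := SubspaceElt { incl :> X; inclP : incl \in cspred }.

HB.instance Definition _ := [isSub for incl].
HB.instance Definition _ := [Choice of subspaceType by <:].
HB.instance Definition _ := [SubChoice_isSubLmodule of subspaceType by <:].

Let snorm (x : subspaceType) : R := `|incl x|.

Let snormD x y : snorm (x + y) <= snorm x + snorm y.
Proof. exact: ler_normD. Qed.

Let snormZ a x : snorm (a *: x) = `|a| * snorm x.
Proof. exact: normrZ. Qed.

Let snorm0_eq0 x : snorm x = 0 -> x = 0.
Proof. by move=> /normr0_eq0 x0; apply: val_inj; rewrite /= x0. Qed.

HB.instance Definition _ :=
  Lmodule_isNormed.Build R subspaceType snormD snormZ snorm0_eq0.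

Lemma norm_incl (x : subspaceType) : `|x| = `|incl x|. Proof. by []. Qed.

Lemma subspace_complete (F : set_system subspaceType) :
  ProperFilter F -> cauchy F -> cvg F.
Proof.
move=> FF /cauchyP Fc.
have : cauchy (incl @ F).
  apply/cauchyP => e e0; have [x Fx] := Fc e e0; exists (incl x).
  rewrite /fmap /=; apply: filterS Fx => y /=.
  by rewrite -!ball_normE.
move=> /cauchy_cvg /cvg_ex[l Fl].
have lY : l \in cspred.
  rewrite /cspred unfold_in inE.
  apply: (closed_cvg _ (@csset_closed _ _ Y) _ _ Fl).
  by apply: nearW => x; move: (inclP x); rewrite /cspred unfold_in inE.
apply/cvg_ex; exists (SubspaceElt lY); apply/cvgrPdist_lt => e e0.
by move/cvgrPdist_lt: Fl => /(_ e e0).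
Qed.

HB.instance Definition _ :=
  Uniform_isComplete.Build subspaceType subspace_complete.

End SubspaceType.

(* The compactness proof is a parameter because the supremum is a norm only on
   bounded functions. *)
Definition contFun (R : realType) (K : topologicalType)
  of compact [set: K] := continuousType K R.

Section ContFun.
Variables (R : realType) (K : topologicalType) (cK : compact [set: K]).
Local Notation CK := (contFun R cK).

Definition cf_pred : {pred K -> R} := fun f => `[< continuous f >].

Lemma cf_predP (f : K -> R) : reflect (continuous f) (f \in cf_pred).
Proof. exact: asboolP. Qed.

Lemma cf_pred_submod_closed : submod_closed cf_pred.
Proof.
split=> [|a f g /cf_predP cf /cf_predP cg]; apply/cf_predP => x.
  exact: cvg_cst.
have cfx : {for x, continuous (a \*: f)} by apply: continuousZl_tmp; exact: cf.
exact: (continuousD cfx (cg x)).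
Qed.

HB.instance Definition _ :=
  GRing.isSubmodClosed.Build R (K -> R) cf_pred cf_pred_submod_closed.

Definition cf_val (f : CK) : K -> R := f : continuousType K R.

Definition cf_Sub (f : K -> R) (fP : f \in cf_pred) : CK :=
  (mkcts (elimT (cf_predP f) fP) : continuousType K R).

Lemma cf_valP (f : CK) : cf_val f \in cf_pred.
Proof. by apply/cf_predP; exact: cts_fun. Qed.

Lemma cf_SubK f fP : cf_val (@cf_Sub f fP) = f. Proof. by []. Qed.

Lemma cf_val_inj : injective cf_val.
Proof. by move=> f g fg; apply/continuousEP => x; rewrite -/(cf_val f x) fg. Qed.

Lemma cf_Sub_rect (P : CK -> Type) :
  (forall f fP, P (@cf_Sub f fP)) -> forall u, P u.
Proof.
move=> PS u; suff -> : u = cf_Sub (cf_valP u) by [].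
exact: cf_val_inj.
Qed.

HB.instance Definition _ := isSub.Build (K -> R) _ CK cf_Sub_rect cf_SubK.
HB.instance Definition _ := [Choice of CK by <:].
HB.instance Definition _ := [SubChoice_isSubLmodule of CK by <:].

Definition supnorm (f : CK) : R := sup [set `|cf_val f x| | x in [set: K]].

Lemma supnorm_has_ubound (f : CK) :
  has_ubound [set `|cf_val f x| | x in [set: K]].
Proof.
have [K0|K0] := pselect ([set: K] !=set0); last first.
  by exists 0 => y [x _ _]; case: K0; exists x.
have : {within [set: K], continuous (fun x => `|cf_val f x|)}.
  apply: continuous_subspaceT => x; apply: cvg_norm.
  by have /cf_predP := cf_valP f; exact.
move=> /(compact_EVT_max K0 cK)[c _ fc].
by exists `|cf_val f c| => _ [x _ <-]; apply: fc; rewrite inE.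
Qed.

Lemma supnorm_ge (f : CK) x : `|cf_val f x| <= supnorm f.
Proof. by apply: ub_le_sup; [exact: supnorm_has_ubound|exists x]. Qed.

Lemma supnorm_le (f : CK) M :
  0 <= M -> (forall x, `|cf_val f x| <= M) -> supnorm f <= M.
Proof.
move=> M0 fM; rewrite /supnorm.
have [->|/set0P S0] := eqVneq [set `|cf_val f x| | x in [set: K]] set0.
  by rewrite sup0.
by apply: ge_sup => // _ [x _ <-].
Qed.

Lemma supnorm_ge0 f : 0 <= supnorm f.
Proof.
rewrite /supnorm.
have [->|/set0P[y [x _ _]]] := eqVneq [set `|cf_val f x| | x in [set: K]] set0.
  by rewrite sup0.
exact: le_trans (supnorm_ge f x).
Qed.

Let supnormD f g : supnorm (f + g) <= supnorm f + supnorm g.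
Proof.
apply: supnorm_le => [|x]; first by rewrite addr_ge0 ?supnorm_ge0.
by apply: le_trans (ler_normD _ _) _; apply: lerD; exact: supnorm_ge.
Qed.

Let supnormZ a f : supnorm (a *: f) = `|a| * supnorm f.
Proof.
have leZ b g : supnorm (b *: g) <= `|b| * supnorm g.
  apply: supnorm_le => [|x]; first by rewrite mulr_ge0 ?supnorm_ge0.
  by apply: (@le_trans _ _ `|b * cf_val g x|) => //; rewrite normrM ler_wpM2l// supnorm_ge.
apply/eqP; rewrite eq_le leZ /=.
have [->|a0] := eqVneq a 0; first by rewrite normr0 mul0r supnorm_ge0.
rewrite -ler_pdivlMl ?normr_gt0// -normfV.
by apply: le_trans (leZ _ _); rewrite scalerA mulVf// scale1r.
Qed.

Let supnorm0_eq0 f : supnorm f = 0 -> f = 0.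
Proof.
move=> f0; apply: cf_val_inj; apply/funext => x; apply/eqP.
by rewrite -normr_le0 -f0 supnorm_ge.
Qed.

HB.instance Definition _ :=
  Lmodule_isNormed.Build R CK supnormD supnormZ supnorm0_eq0.

Lemma norm_contFun (f : CK) : `|f| = supnorm f. Proof. by []. Qed.

Lemma contFun_complete (F : set_system CK) :
  ProperFilter F -> cauchy F -> cvg F.
Proof.
move=> FF /cauchyP Fc.
have dist_le (f g : CK) x : `|cf_val f x - cf_val g x| <= `|f - g|.
  exact: (supnorm_ge (f - g)).
pose ev x (f : CK) := cf_val f x.
have evc x : cvg (ev x @ F).
  apply: cauchy_cvg; apply/cauchyP => e e0.
  have [f Ff] := Fc e e0; exists (ev x f); rewrite /fmap /=.
  apply: filterS Ff => g; rewrite -!ball_normE /=.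
  exact: le_lt_trans (dist_le _ _ _).
pose g x : R := lim (ev x @ F).
have Fg e : 0 < e -> \forall f \near F, forall x, `|g x - cf_val f x| <= e.
  move=> e0; have [f Ff] := Fc (e / 2) (divr_gt0 e0 (ltr0Sn _ 1)).
  have Ff' : \forall h \near F, forall x, `|cf_val f x - cf_val h x| <= e / 2.
    apply: filterS Ff => h; rewrite -ball_normE /= => /ltW fh x.
    exact: le_trans (dist_le _ _ _) fh.
  have fg x : `|cf_val f x - g x| <= e / 2.
    have fgc : (fun h => `|cf_val f x - ev x h|) @ F --> `|cf_val f x - g x|.
      by apply: cvg_norm; apply: cvgB; [exact: cvg_cst|exact: evc].
    rewrite -(cvg_lim (@Rhausdorff R) fgc); apply: limr_le.
      by apply/cvg_ex; exists `|cf_val f x - g x|.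
    by apply: filterS Ff' => h; exact.
  apply: filterS Ff' => h fh x; rewrite (splitr e).
  by apply: le_trans (ler_distD (cf_val f x) _ _) _; rewrite lerD// distrC.
have gc : g \in cf_pred.
  apply/cf_predP => x; apply/cvgrPdist_le => e e0.
  have e30 : 0 < e / 3 by rewrite divr_gt0.
  have [f gf] := filter_ex (Fg _ e30).
  have /cf_predP/(_ x)/cvgrPdist_le/(_ _ e30) := cf_valP f.
  apply: filterS => y fxy.
  have -> : g x - g y = (g x - cf_val f x) + (cf_val f x - cf_val f y)
      + (cf_val f y - g y) by rewrite !addrA !subrK.
  have -> : e = e / 3 + e / 3 + e / 3 by field.
  apply: le_trans (ler_normD _ _) _; apply: lerD; last by rewrite distrC.
  by apply: le_trans (ler_normD _ _) _; apply: lerD.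
apply/cvg_ex; exists (cf_Sub gc); apply/cvgrPdist_le => e e0.
apply: filterS (Fg e e0) => f gf.
by rewrite norm_contFun; apply: supnorm_le; [exact: ltW|exact: gf].
Qed.

HB.instance Definition _ := Uniform_isComplete.Build CK contFun_complete.

End ContFun.

(* The order is a field of its own, since Hierarchy Builder cannot add a common
   extension of Order.Lattice and the module structures above realDomainType. *)
HB.mixin Record isBanachLattice (R : realType) (X : Type)
    of CompleteNormedModule R X := {
  bl_le : rel X;
  bl_join : X -> X -> X;
  bl_meet : X -> X -> X;
  bl_le_refl : reflexive bl_le;
  bl_le_anti : antisymmetric bl_le;
  bl_le_trans : transitive bl_le;
  bl_joinP : forall x y z : X, bl_le (bl_join x y) z = bl_le x z && bl_le y z;
  bl_meetP : forall x y z : X, bl_le z (bl_meet x y) = bl_le z x && bl_le z y;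
  bl_leD2r : forall z x y : X, bl_le x y -> bl_le (x + z) (y + z);
  bl_leZ2l : forall (a : R) (x y : X),
    0 <= a -> bl_le x y -> bl_le (a *: x) (a *: y);
  bl_norm_solid : forall x y : X,
    bl_le (bl_join x (- x)) (bl_join y (- y)) -> `|x| <= `|y| }.

#[short(type="banachLatticeType")]
HB.structure Definition BanachLattice (R : realType) :=
  {X of CompleteNormedModule R X & isBanachLattice R X}.

Definition M_space (R : realType) (X : banachLatticeType R) : Prop :=
  forall x y : X, bl_le 0 x -> bl_le 0 y ->
    `|bl_join x y| = Num.max `|x| `|y|.

Definition complemented (R : realType) (X : completeNormedModType R)
    (Y : closedSubspace X) : Prop :=
  exists P : {linear X -> X},
    [/\ exists M : R, forall x, `|P x| <= M * `|x|,
        idempotent_fun P & range P = Y].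

Definition finite_dimensional (R : realType) (X : completeNormedModType R) :
    Prop :=
  exists (n : nat) (e : 'I_n -> X),
    forall x, exists c : 'I_n -> R, x = \sum_(i < n) c i *: e i.

Definition isometric_embedding (R : realType) (X Y : completeNormedModType R)
    (f : {linear X -> Y}) : Prop :=
  forall x, `|f x| = `|x|.

Definition eps_isometric_embedding (R : realType)
    (X Y : completeNormedModType R) (eps : R) (f : {linear X -> Y}) : Prop :=
  forall x, x != 0 -> (1 + eps)^-1 * `|x| <= `|f x| <= (1 + eps) * `|x|.

Definition gurarii (R : realType) (X : completeNormedModType R) : Prop :=
  forall (T : completeNormedModType R) (S : closedSubspace T),
    finite_dimensional T ->
  forall f : {linear subspaceType S -> X}, isometric_embedding f ->
  forall eps : R, 0 < eps ->
  exists g : {linear T -> X},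
    eps_isometric_embedding eps g /\
    forall s : subspaceType S, g (incl s) = f s.

(* Main.v *)
From HB Require Import structures.
From mathcomp Require Import all_boot all_order all_algebra ring lra.
From mathcomp Require Import all_classical all_reals all_analysis.
Require Import Defs.

(** Let [Z] be a Gurarii space, [i] an isometric embedding of [Z] into an M-space [X]
    and [Q] a bounded operator from [X] to [Z] with [Q (i z) = z]; a complemented
    Gurarii subspace gives such data.  Consider the [h] in [X] whose modulus is
    dominated by a finite supremum of moduli [|i e|] with [e] in the unit ball of [Z]
    (the [hull]).  Since [X] is an M-space they satisfy [`|h| <= 1], so the supremum
    [lam] of the numbers [`|Q h|] over the hull is finite.  The proof produces an
    element of the hull, up to a factor close to 1, whose image has norm at least
    [lam + 1/2].

    Take [h] in the hull with [`|Q h|] close to [lam].  It is enough to find [v] in [Z]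
    such that [h + i v] is still in the hull and [`|Q h + v|] is close to
    [`|Q h| + 1].  The second property is easy to obtain: for a functional [l2] of norm
    at most 1, a Gurarii space contains [v] with
    [`|e + c *: v|] close to [max (`|e|, |l2 e + c|)] for all [e] in a given
    finite-dimensional subspace ([gurarii_vector]), so [l2] only has to almost norm
    [Q h].  However [|e| + |v|] leaves the unit ball when [l2 e] is not 0.

    The remedy is to spread [l2] over two functionals.  Let [l] norm [Q h], and use the
    Gurarii property to get vectors [u_0, ..., u_n] with biorthogonal functionals
    [phi_0, ..., phi_n] which all agree with [l] on [Q h] and on the [e] that dominate
    [h].  Take for [l2] the mean of some [phi_p] and [phi_q].  Then [l2] vanishes at
    [e - 2 l(e) u_p] and at [e - 2 l(e) u_q], so that both of these are compatible
    with [v].  It follows that [|e| + |v|] exceeds the unit ball by at most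
    [2 |u_p|] and by at most [2 |u_q|], hence by at most twice their infimum; removing
    from [h] its truncation [g_pq] at this level makes room for [v]
    ([hull_reflect]).

    The removal changes [l2 (Q h)] by the mean of [phi_p (Q g_pq)] and
    [phi_q (Q g_pq)].  For fixed [q] the sum of the [g_pq] over [p] is dominated by the
    sum of the [2 |u_p|], whose norm is about 2 whatever [n] is, because in an M-space
    it is attained at a signed sum of the [u_p] ([sum_clip_le]).  So the sum over [p] of
    [phi_q (Q g_pq)] is bounded independently of [n], and for large [n] some pair
    makes the loss negligible ([small_pair]).

    Spaces of continuous functions are M-spaces for the pointwise order. *)

Set Implicit Arguments.
Unset Strict Implicit.
Unset Printing Implicit Defensive.

Import Order.TTheory GRing.Theory Num.Theory.
Import numFieldNormedType.Exports.

Local Open Scope classical_set_scope.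
Local Open Scope ring_scope.

(** * The Hahn-Banach theorem *)

Section HahnBanach.
Variables (R : realType) (Z : normedModType R) (C : R).

(** Partial linear functionals are handled through their graphs, which turns
    extension of functionals into inclusion of sets. *)
Definition linear_graph (A : set (Z * R)) : Prop :=
  forall (c : R) p q, A p -> A q -> A (c *: p.1 + q.1, c * p.2 + q.2).

Definition dominated_graph (A : set (Z * R)) : Prop :=
  forall p, A p -> p.2 <= C * `|p.1|.

Lemma graph_scale (A : set (Z * R)) (c : R) p :
  linear_graph A -> A p -> A (c *: p.1, c * p.2).
Proof.
move=> lA Ap.
have A0 : A (0, 0).
  have := lA (-1) p p Ap Ap.
  by rewrite scaleN1r addNr mulN1r addNr.
by have := lA c p (0, 0) Ap A0; rewrite /= !addr0.
Qed.

(** Domination by a multiple of the norm forces a linear graph to be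
    single-valued: a value at [0] is at most [0], and so is its opposite. *)
Lemma dominated_graph_fun (A : set (Z * R)) x r s :
  linear_graph A -> dominated_graph A -> A (x, r) -> A (x, s) -> r = s.
Proof.
move=> lA dA Ar As; apply/eqP; rewrite eq_le.
have le a b : A (x, a) -> A (x, b) -> b <= a.
  move=> Aa Ab; have := dA _ (lA (-1) _ _ Aa Ab).
  by rewrite /= scaleN1r addNr normr0 mulr0 mulN1r addrC subr_le0.
by rewrite !le.
Qed.

(** The value at a new point [x0] has to lie between the numbers
    [p.2 - C * `|p.1 - x0|] and the numbers [C * `|p.1 + x0| - p.2]; the triangle
    inequality separates the two families, so the supremum of the first works. *)
Lemma dominated_graph_step (A : set (Z * R)) (x0 : Z) :
    0 <= C -> A !=set0 -> linear_graph A -> dominated_graph A ->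
  exists c : R, forall p t, A p -> p.2 + t * c <= C * `|p.1 + t *: x0|.
Proof.
move=> C0 [p0 Ap0] lA dA.
have sep p q : A p -> A q -> p.2 - C * `|p.1 - x0| <= C * `|q.1 + x0| - q.2.
  move=> Ap Aq; rewrite lerBlDr addrAC lerBrDr.
  have := dA _ (lA 1 _ _ Ap Aq); rewrite /= scale1r mul1r => /le_trans; apply.
  rewrite -mulrDr ler_wpM2l// (_ : p.1 + q.1 = q.1 + x0 + (p.1 - x0)) ?ler_normD//.
  by rewrite addrACA subrr addr0 addrC.
pose S := [set p.2 - C * `|p.1 - x0| | p in A].
have S0 : S !=set0 by exists (p0.2 - C * `|p0.1 - x0|), p0.
have Sub p : A p -> forall y, S y -> y <= C * `|p.1 + x0| - p.2.
  by move=> Ap _ [q Aq <-]; exact: sep.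
exists (sup S) => p t Ap.
have [t0|t0|->] := ltgtP t 0; last first.
- by rewrite mul0r scale0r !addr0; exact: dA.
- have Atp := graph_scale t^-1 lA Ap.
  have := ge_sup S0 (Sub _ Atp); rewrite /= lerBrDr => /(ler_wpM2l (ltW t0)).
  rewrite mulrDr mulrA mulfV ?gt_eqF// mul1r addrC => /le_trans; apply.
  rewrite mulrCA -{1}(gtr0_norm t0) -normrZ scalerDr scalerA mulfV ?gt_eqF//.
  by rewrite scale1r.
- have u0 : 0 < - t by rewrite oppr_gt0.
  have Atp := graph_scale (- t)^-1 lA Ap.
  have : (- t)^-1 * p.2 - C * `|(- t)^-1 *: p.1 - x0| <= sup S.
    apply: ub_le_sup; last by exists ((- t)^-1 *: p.1, (- t)^-1 * p.2).
    by exists (C * `|p0.1 + x0| - p0.2); exact: Sub.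
  rewrite lerBlDr -lerBlDl => /(ler_wpM2l (ltW u0)).
  rewrite mulrBr mulrA mulfV ?gt_eqF// mul1r mulNr opprK => /le_trans; apply.
  rewrite mulrCA -{1}(gtr0_norm u0) -normrZ scalerBr scalerA mulfV ?gt_eqF//.
  by rewrite scale1r scaleNr opprK.
Qed.

(** A maximal dominated linear graph above [A0] exists by Zorn's lemma and is
    total by the one-point extension, hence is the graph of a functional. *)
Theorem hahn_banach (A0 : set (Z * R)) :
    0 <= C -> A0 !=set0 -> linear_graph A0 -> dominated_graph A0 ->
  exists phi : {linear Z -> R^o},
    (forall x, `|phi x| <= C * `|x|) /\ (forall p, A0 p -> phi p.1 = p.2).
Proof.
move=> C0 A0n0 lA0 dA0.
pose P A := [/\ (A !=set0 -> A0 `<=` A), linear_graph A & dominated_graph A].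
have [A [[A0A lA dA] maxA]] : exists A, P A /\ forall B, A `<` B -> ~ P B.
  (* The empty chain has the empty union, so [P] must allow the empty graph. *)
  apply: Zorn_bigcup => F FP Ftot; split.
  - move=> [p [A FA Ap]] q A0q; exists A => //.
    by have [A0A _ _] := FP _ FA; apply: A0A => //; exists p.
  - move=> c p q [A FA Ap] [B FB Bq].
    have [AB|BA] := Ftot _ _ FA FB.
      by exists B => //; have [_ + _] := FP _ FB; apply => //; exact: AB.
    by exists A => //; have [_ + _] := FP _ FA; apply => //; exact: BA.
  - by move=> p [A FA Ap]; have [_ _] := FP _ FA; exact.
have An0 : A !=set0.
  apply: contrapT => /nonemptyPn A_0; apply: (maxA A0); last by split=> [_ ? ||].
  by rewrite A_0; split=> // A00; case: A0n0 => p /A00.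
have {}A0A := A0A An0.
have domA x : exists r, A (x, r).
  have [c hc] := dominated_graph_step x C0 An0 lA dA.
  pose B := [set q : Z * R | exists p t, A p /\ q = (p.1 + t *: x, p.2 + t * c)].
  have AB : A `<=` B.
    by move=> [y s] Ap; exists (y, s), 0; split=> //=; rewrite scale0r mul0r !addr0.
  have PB : P B.
    split.
    - by move=> _ q /A0A/AB.
    - move=> d _ _ [p [t [Ap ->]]] [q [u [Aq ->]]] /=.
      exists (d *: p.1 + q.1, d * p.2 + q.2), (d * t + u); split; first exact: lA.
      congr pair => /=; last by ring.
      by rewrite scalerDr scalerA scalerDl addrACA.
    - by move=> _ [p [t [Ap ->]]]; exact: hc.
  have Bx : B (x, c).
    have [p Ap] := An0.
    exists (0 *: p.1, 0 * p.2), 1; split; first exact: graph_scale.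
    by rewrite /= scale0r mul0r !add0r scale1r mul1r.
  exists c; apply: contrapT => nAx; apply: (maxA B) => //; split=> //.
  by move=> BA; apply/nAx/BA.
pose phi x := projT1 (cid (domA x)).
have phiP x : A (x, phi x) by exact: projT2 (cid (domA x)).
have phi_uniq x r : A (x, r) -> phi x = r.
  by move=> Axr; exact: dominated_graph_fun lA dA (phiP x) Axr.
have phi_lin : linear (phi : Z -> R^o).
  by move=> c x y; apply: phi_uniq; exact: (lA c _ _ (phiP x) (phiP y)).
pose L := GRing.isLinear.Build _ _ _ _ _ phi_lin.
pose phil : {linear Z -> R^o} := HB.pack (phi : Z -> R^o) L.
exists phil; split; last by move=> [x r] /A0A /=; exact: phi_uniq.
move=> x; rewrite /= ler_norml; apply/andP; split; last exact: dA (phiP x).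
have := dA _ (phiP (- x)); rewrite normrN /= lerNl.
by rewrite -[phi x]/(phil x) -[phi (- x)]/(phil (- x)) linearN.
Qed.

End HahnBanach.

(** * Completeness of products and of spaces of matrices *)

HB.instance Definition _ (R : realType) m n :=
  Uniform_isComplete.Build 'M[R]_(m, n) (@cauchy_cvg 'M[R]_(m, n)).
(* Stated over this base, the known base point of a product combines with its norm
   and uniform structure, as completeness requires. *)
HB.instance Definition _ (R : realType) (U V : completeNormedModType R) :=
  Pointed.copy (U * V)%type (U * V)%type.

Lemma prod_complete (R : realType) (U V : completeNormedModType R)
  (F : set_system (U * V)) : ProperFilter F -> cauchy F -> cvg F.
Proof.
move=> FF /cauchyP Fc.
have c1 : cvg (fst @ F).
  apply: cauchy_cvg; apply/cauchyP => e e0; have [x Fx] := Fc e e0.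
  exists x.1; rewrite /fmap /=; apply: filterS Fx => y; rewrite -!ball_normE /=.
  by apply: le_lt_trans; rewrite [leRHS]prod_normE le_max lexx.
have c2 : cvg (snd @ F).
  apply: cauchy_cvg; apply/cauchyP => e e0; have [x Fx] := Fc e e0.
  exists x.2; rewrite /fmap /=; apply: filterS Fx => y; rewrite -!ball_normE /=.
  by apply: le_lt_trans; rewrite [leRHS]prod_normE le_max lexx orbT.
apply/cvg_ex; exists (lim (fst @ F), lim (snd @ F)).
have -> : F = (fun x : U * V => (x.1, x.2)) @ F.
  by rewrite (_ : (fun x : U * V => (x.1, x.2)) = id) //; apply/funext => -[].
exact: cvg_pair c1 c2.
Qed.

HB.instance Definition _ (R : realType) (U V : completeNormedModType R) :=
  Uniform_isComplete.Build (U * V)%type (@prod_complete R U V).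

(** * Finite-dimensional subspaces *)

Section LinearSpan.
Variables (R : realType).

Lemma closed_preimage_lipschitz (U V : normedModType R) (K : R) (f : U -> V)
    (D : set V) :
  (forall x y, `|f x - f y| <= K * `|x - y|) -> closed D -> closed (f @^-1` D).
Proof.
move=> fK; apply: preimage_closed => x _.
have fL y : `|f x - f y| <= (`|K| + 1) * `|x - y|.
  apply: le_trans (fK x y) _; rewrite ler_wpM2r//.
  by apply: le_trans (ler_norm _) _; rewrite lerDl.
apply/cvgrPdist_lt => e e0.
have K0 : 0 < `|K| + 1 by rewrite ltr_wpDl.
have : \forall y \near x, `|x - y| < e / (`|K| + 1).
  by apply: (@cvgr_dist_lt _ _ _ _ _ id) => //; rewrite divr_gt0.
apply: filterS => y; rewrite ltr_pdivlMr// mulrC; exact: le_lt_trans.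
Qed.

Fixpoint lspan (Z : lmodType R) (s : seq Z) : set Z :=
  if s is v :: s' then [set x | exists c : R, lspan s' (x - c *: v)]
  else [set 0].

Lemma lspan_lin (Z : lmodType R) (s : seq Z) (c : R) x y :
  lspan s x -> lspan s y -> lspan s (c *: x + y).
Proof.
elim: s x y => [x y /= -> ->|v s IH x y /= [a sx] [b sy]].
  by rewrite scaler0 addr0.
exists (c * a + b); have := IH _ _ sx sy; congr lspan.
by rewrite scalerBr scalerA scalerDl opprD addrACA.
Qed.

Lemma lspan0 (Z : lmodType R) (s : seq Z) : lspan s 0.
Proof. by elim: s => //= v s s0; exists 0; rewrite scale0r subr0. Qed.

Lemma lspan_mem (Z : lmodType R) (s : seq Z) x : x \in s -> lspan s x.
Proof.
elim: s => //= v s IH; rewrite inE => /predU1P[->|/IH sx].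
  by exists 1; rewrite scale1r subrr; exact: lspan0.
by exists 0; rewrite scale0r subr0.
Qed.

Lemma lspan_sum (Z : lmodType R) (s : seq Z) x : lspan s x ->
  exists c : 'I_(size s) -> R, x = \sum_(i < size s) c i *: s`_i.
Proof.
elim: s x => [x /= ->|v s IH x /= [a /IH[c xE]]].
  by exists (fun=> 0); rewrite big_ord0.
exists (fun i => if unlift ord0 i is Some j then c j else a).
rewrite big_ord_recl unlift_none /=.
under eq_bigr do rewrite liftK.
by rewrite -xE addrC subrK.
Qed.

(** By induction: if [v] is not in the closed span [F] of the other vectors, its
    distance to [F] is positive, so the coordinate along [v] is bounded on
    [F + R v].  Its Hahn-Banach extension [phi] describes [F + R v] as the preimage
    of [F] under the Lipschitz map [x |-> x - phi x *: v]. *)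
Lemma lspan_closed (Z : normedModType R) (s : seq Z) : closed (lspan s).
Proof.
elim: s => [|v s IH] /=.
  by apply: accessible_closed_set1; apply: hausdorff_accessible; exact: norm_hausdorff.
have [vs|vs] := pselect (lspan s v).
  rewrite (_ : [set x | _] = lspan s)//; apply/seteqP; split=> [x [c sx]|x sx] /=.
    by have := lspan_lin c vs sx; rewrite addrC subrK.
  by exists 0; rewrite scale0r subr0.
have [r r0 sr] : exists2 r : R, 0 < r & forall y, lspan s y -> r <= `|v - y|.
  have /open_nbhs_nbhs : open_nbhs v (~` lspan s).
    by split=> //; exact: closed_openC.
  move=> /nbhs_normP[r /= r0 vr]; exists r => // y sy.
  by rewrite leNgt; apply/negP => vy; exact: (vr y).
pose G : set (Z * R) := [set p | lspan s (p.1 - p.2 *: v)].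
have lG : linear_graph G.
  move=> c p q Gp Gq; rewrite /G /=; have := lspan_lin c Gp Gq; congr lspan.
  by rewrite scalerBr scalerA scalerDl opprD addrACA.
have dG : dominated_graph r^-1 G.
  move=> [x t] /= Gx; rewrite mulrC ler_pdivlMr//.
  apply: (@le_trans _ _ (`|t| * r)); first by rewrite ler_pM2r// ler_norm.
  have [->|t0] := eqVneq t 0; first by rewrite normr0 mul0r.
  rewrite -ler_pdivlMl ?normr_gt0// -normfV -normrZ.
  have /sr : lspan s (v - t^-1 *: x).
    have := lspan_lin (- t^-1) Gx (lspan0 s); rewrite addr0; congr lspan.
    by rewrite scaleNr scalerBr scalerA mulVf// scale1r opprB.
  by rewrite opprB addrC subrK.
have [||phi [phiC phiG]] := hahn_banach _ _ lG dG.
- by rewrite invr_ge0 ltW.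
- by exists (0, 0); rewrite /G /= scale0r subr0; exact: lspan0.
rewrite (_ : [set x | _] = (fun x => x - (phi x : R) *: v) @^-1` lspan s).
  apply: (closed_preimage_lipschitz (K := 1 + r^-1 * `|v|)) IH => x y.
  have -> : x - (phi x : R) *: v - (y - (phi y : R) *: v)
      = x - y - (phi (x - y) : R) *: v.
    have -> : phi (x - y) = (phi x : R) - phi y :> R by exact: linearB.
    by rewrite scalerBl opprD addrACA; congr (_ + _); rewrite opprB opprK addrC.
  apply: le_trans (ler_normB _ _) _.
  by rewrite mulrDl mul1r lerD// normrZ mulrAC ler_wpM2r.
apply/seteqP; split=> [x [c sx]|x sx] /=; last by exists (phi x).
by have := phiG (x, c) sx => /= ->.
Qed.

End LinearSpan.

(** * Adjoining coordinates to a Gurarii space *)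

Section RowNorm.
Variables (R : realType) (n : nat).

Lemma rv_norm_ge (a : 'rV[R]_n) i : `|a ord0 i| <= `|a|.
Proof.
rewrite [leRHS]/Num.norm /= mx_normrE.
by apply: (le_bigmax _ (fun ij => `|a ij.1 ij.2|) (ord0, i)).
Qed.

Lemma rv_norm_le (a : 'rV[R]_n) C :
  0 <= C -> (forall i, `|a ord0 i| <= C) -> `|a| <= C.
Proof.
move=> C0 aC; rewrite [leLHS]/Num.norm /= mx_normrE; apply/bigmax_leP; split=> //.
by move=> [i j] _ /=; rewrite (ord1 i).
Qed.

End RowNorm.

(** Let [E] be the span of [s].  By way of [e |-> (e, (l e, ..., l e))] the space [E]
    embeds isometrically into [T], the product of [E] and [R^n] with the maximum
    norm; its image is the subspace [S].  A Gurarii space containing [E] therefore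
    contains an almost isometric copy of [T] above [E], and the vectors of the second
    factor are as if the dual ball of [E] had received [n] new extreme points, all of
    which restrict to [l] on [E]. *)
Section GurariiExtension.
Variables (R : realType) (Z : completeNormedModType R).
Variables (s : seq Z) (l : {linear Z -> R^o}) (n : nat).
Hypothesis l_le : forall x, `|l x| <= `|x|.

Let E := ClosedSubspace (lspan0 s) (@lspan_lin R Z s) (@lspan_closed R Z s).
Let T : completeNormedModType R := (subspaceType E * 'rV[R]_n)%type.

Let mkE x (sx : lspan s x) : subspaceType E :=
  @SubspaceElt _ _ E x (mem_set sx).

Let T_fin : finite_dimensional T.
Proof.
have Es (i : 'I_(size s)) : lspan s s`_i by apply: lspan_mem; exact: mem_nth.
exists (size s + n)%N, (fun k : 'I_(size s + n) => match fintype.split k with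
  | inl i => (mkE (Es i), 0) | inr j => (0, delta_mx ord0 j) end).
move=> [e a].
have /lspan_sum[c ec] : lspan s (incl e) by have := inclP e; rewrite /cspred inE.
exists (fun k : 'I_(size s + n) => match fintype.split k with
  | inl i => c i | inr j => a ord0 j end).
rewrite big_split_ord /=.
under eq_bigr do rewrite (unsplitK (inl _)).
under [X in _ + X]eq_bigr do rewrite (unsplitK (inr _)).
have sum1 m (G : 'I_m -> T) : (\sum_(i < m) G i).1 = \sum_(i < m) (G i).1.
  by apply: (big_morph (fst : T -> _)).
have sum2 m (G : 'I_m -> T) : (\sum_(i < m) G i).2 = \sum_(i < m) (G i).2.
  by apply: (big_morph (snd : T -> _)).
rewrite [RHS]surjective_pairing; congr pair.
  rewrite [RHS]/= !sum1 [X in _ + X]big1 ?addr0; last first.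
    by move=> j _; rewrite /= scaler0.
  apply: val_inj; rewrite /= (big_morph (@incl R Z E) (fun _ _ => erefl) erefl) ec.
  by apply: eq_bigr.
rewrite [RHS]/= !sum2 big1 ?add0r => [|i _]; last by rewrite /= scaler0.
exact: row_sum_delta.
Qed.

Let F (x : T) : 'rV[R]_n := x.2 - const_mx (l (incl x.1) : R).
Let Sset : set T := F @^-1` [set 0].

Let FD c x y : F (c *: x + y) = c *: F x + F y.
Proof.
rewrite /F; apply/rowP => i; rewrite !mxE.
rewrite -[incl (c *: x + y).1]/(c *: incl x.1 + incl y.1) linearP /=.
rewrite /GRing.scale /=. ring.
Qed.

Let S0 : Sset 0.
Proof. by have := FD (-1) 0 0; rewrite /Sset /= !scaleN1r !addNr. Qed.

Let SP c x y : Sset x -> Sset y -> Sset (c *: x + y).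
Proof. by rewrite /Sset /= FD => -> ->; rewrite scaler0 addr0. Qed.

Let S_closed : closed Sset.
Proof.
apply: (closed_preimage_lipschitz (K := 2)); last first.
  by apply: accessible_closed_set1; apply: hausdorff_accessible; exact: norm_hausdorff.
move=> x y.
have -> : F x - F y = F (x - y) by have := FD (-1) y x; rewrite !scaleN1r !(addrC (- _)).
move: (x - y) => {x y} [e a].
rewrite mulr_natl mulr2n; apply: le_trans (ler_normB _ _) _; apply: lerD.
  by rewrite [leRHS]prod_normE le_max lexx orbT.
apply: rv_norm_le => // i; rewrite mxE; apply: le_trans (l_le _) _.
by rewrite [leRHS]prod_normE le_max lexx.
Qed.

Let S := ClosedSubspace S0 SP S_closed.

Let f0 (x : subspaceType S) : Z := incl (incl x).1.
Let f0_linear : linear f0. Proof. by []. Qed.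
HB.instance Definition _ := GRing.isLinear.Build _ _ _ _ f0 f0_linear.
Let f : {linear subspaceType S -> Z} := f0.

Lemma gurarii_extension eps : gurarii Z -> 0 < eps ->
  exists u : {linear 'rV[R]_n -> Z}, forall e a, lspan s e ->
    (1 + eps)^-1 * Num.max `|e| `|const_mx (l e : R) + a| <= `|e + u a| /\
    `|e + u a| <= (1 + eps) * Num.max `|e| `|const_mx (l e : R) + a|.
Proof.
move=> GZ eps0.
have f_iso : isometric_embedding f.
  move=> x; rewrite [RHS]norm_incl prod_normE.
  have /set_mem : incl x \in Sset by exact: (inclP x).
  rewrite /Sset /= /F => /eqP; rewrite subr_eq0 => /eqP ->.
  apply/esym/max_l; apply: rv_norm_le => // i; rewrite mxE; exact: l_le.
have [g [g_eps gf]] := GZ T S T_fin f f_iso eps eps0.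
pose u0 (a : 'rV[R]_n) : Z := g (0, a).
have u0_lin : linear u0.
  by move=> c a b; rewrite /u0 -linearP; congr (g _); congr pair; rewrite /= scaler0 addr0.
pose u : {linear 'rV[R]_n -> Z} := HB.pack u0 (GRing.isLinear.Build _ _ _ _ _ u0_lin).
exists u => e a se.
pose b : 'rV[R]_n := const_mx (l e : R).
have Sb : Sset (mkE se, b) by rewrite /Sset /= /F subrr.
have <- : g (mkE se, b + a) = e + u a.
  have -> : (mkE se, b + a) = (mkE se, b) + (0, a) :> T by congr pair; rewrite /= addr0.
  rewrite linearD; congr (_ + _).
  exact: (gf (@SubspaceElt _ _ S (mkE se, b) (mem_set Sb))).
rewrite -[`|e|]/(`|mkE se|) -(prod_normE (mkE se, b + a)).
have [->|x0] := eqVneq (mkE se, b + a) 0; first by rewrite linear0 !normr0 !mulr0.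
by have /andP[] := g_eps _ x0.
Qed.

End GurariiExtension.

(** * Banach lattices and M-spaces *)

Section VectorLattice.
Variables (R : realType) (X : banachLatticeType R).
Implicit Types x y z a b A B q h : X.

Local Notation "x <=: y" := (bl_le x y) (at level 70, no associativity).

Definition babs x : X := bl_join x (- x).

Lemma bl_leD x y z a : x <=: y -> z <=: a -> x + z <=: y + a.
Proof.
move=> xy za; apply: bl_le_trans (bl_leD2r z _ _ xy) _.
by rewrite ![y + _]addrC; exact: bl_leD2r.
Qed.

Lemma bl_leBr x y z : (x <=: y - z) = (x + z <=: y).
Proof.
apply/idP/idP => [|] H.
  by have := bl_leD2r z _ _ H; rewrite subrK.
by have := bl_leD2r (- z) _ _ H; rewrite addrK.
Qed.

Lemma bl_leBl x y z : (x - y <=: z) = (x <=: z + y).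
Proof. by rewrite -{1}[z](addrK y) bl_leBr subrK. Qed.

Lemma bl_leN x y : x <=: y -> - y <=: - x.
Proof.
move=> H; have := bl_leD2r (- x - y) _ _ H.
by rewrite addrA subrr sub0r addrCA subrr addr0.
Qed.

Lemma bl_le_joinl x y : x <=: bl_join x y.
Proof. by have := bl_le_refl (bl_join x y); rewrite bl_joinP => /andP[]. Qed.

Lemma bl_le_joinr x y : y <=: bl_join x y.
Proof. by have := bl_le_refl (bl_join x y); rewrite bl_joinP => /andP[]. Qed.

Lemma bl_meet_lel x y : bl_meet x y <=: x.
Proof. by have := bl_le_refl (bl_meet x y); rewrite bl_meetP => /andP[]. Qed.

Lemma bl_meet_ler x y : bl_meet x y <=: y.
Proof. by have := bl_le_refl (bl_meet x y); rewrite bl_meetP => /andP[]. Qed.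

Lemma bl_meetC x y : bl_meet x y = bl_meet y x.
Proof.
by apply: bl_le_anti; rewrite !bl_meetP !bl_meet_lel !bl_meet_ler.
Qed.

Lemma babs_le x B : (babs x <=: B) = (x <=: B) && (- x <=: B).
Proof. exact: bl_joinP. Qed.

Lemma babsN x : babs (- x) = babs x.
Proof.
apply: bl_le_anti; rewrite /babs opprK !bl_joinP.
by rewrite !bl_le_joinl !bl_le_joinr.
Qed.

Lemma babs_ge0 x : 0 <=: babs x.
Proof.
have h2 : (0 : R) <= 2^-1 by rewrite invr_ge0.
have := bl_leZ2l _ _ _ h2 (bl_leD (bl_le_joinl x (- x)) (bl_le_joinr x (- x))).
rewrite subrr scaler0 -/(babs x) -[babs x + _]mulr2n -[babs x *+ 2]scaler_nat.
by rewrite scalerA mulVf ?pnatr_eq0// scale1r.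
Qed.

Lemma babs_id x : 0 <=: x -> babs x <=: x.
Proof.
move=> x0; rewrite babs_le bl_le_refl; apply: bl_le_trans (x0).
by have := bl_leN x0; rewrite oppr0.
Qed.

Lemma babsD x y : babs (x + y) <=: babs x + babs y.
Proof.
by rewrite babs_le opprD !bl_leD// ?bl_le_joinl ?bl_le_joinr.
Qed.

Lemma babs_sum (I : Type) (r : seq I) (P : pred I) (F : I -> X) :
  babs (\sum_(i <- r | P i) F i) <=: \sum_(i <- r | P i) babs (F i).
Proof.
elim/big_ind2: _ => [|x A y B xA yB|i _]; last exact: bl_le_refl.
  by rewrite babs_le oppr0 bl_le_refl.
by apply: bl_le_trans (babsD _ _) _; exact: bl_leD.
Qed.

Lemma bl_le_sum (I : Type) (r : seq I) (P : pred I) (F G : I -> X) :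
  (forall i, P i -> F i <=: G i) ->
  \sum_(i <- r | P i) F i <=: \sum_(i <- r | P i) G i.
Proof.
move=> FG; elim/big_ind2: _ => //; first exact: bl_le_refl.
by move=> x A y B; exact: bl_leD.
Qed.

Lemma bl_leZr (c d : R) x : c <= d -> 0 <=: x -> c *: x <=: d *: x.
Proof.
rewrite -subr_ge0 => cd x0; have := bl_leZ2l _ _ _ cd x0.
by rewrite scaler0 scalerBl bl_leBr add0r.
Qed.

Lemma babsZ_le (c d : R) x : `|c| <= d -> babs (c *: x) <=: d *: babs x.
Proof.
move=> cd; suff : babs (c *: x) <=: `|c| *: babs x.
  by move=> /bl_le_trans; apply; exact: bl_leZr (babs_ge0 x).
have [c0|c0] := leP 0 c.
  by rewrite ger0_norm// babs_le -scalerN !bl_leZ2l ?bl_le_joinl ?bl_le_joinr.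
rewrite ltr0_norm// -[c in c *: x]opprK scaleNr babsN babs_le -scalerN.
by rewrite !bl_leZ2l ?bl_le_joinl ?bl_le_joinr// oppr_ge0 ltW.
Qed.

(** This is the half of [|a| + |b| = sup (|a + b|, |a - b|)] that bounds the sum of
    two moduli by linear combinations of the vectors. *)
Lemma babsD_le a b B :
  babs (a + b) <=: B -> babs (a - b) <=: B -> babs a + babs b <=: B.
Proof.
rewrite !babs_le => /andP[h1 h2] /andP[h3 h4].
rewrite -bl_leBr babs_le; apply/andP; split.
  rewrite bl_leBr addrC -bl_leBr babs_le !bl_leBr.
  by rewrite [b + a]addrC h1 [- b + a]addrC h3.
rewrite bl_leBr addrC -bl_leBr babs_le !bl_leBr.
by rewrite -[b - a]opprB h4 -opprD [b + a]addrC h2.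
Qed.

Lemma norm_babs_le x B : babs x <=: B -> `|x| <= `|B|.
Proof. by move=> xB; apply: bl_norm_solid; exact: bl_le_trans xB (bl_le_joinl _ _). Qed.

(** For [q >= 0] the element [h - clip q h] is the soft thresholding of [h] at level
    [q]: its modulus is the positive part of [|h| - q]. *)
Definition clip q h : X := bl_join (bl_meet h q) (- q).

Lemma clip_le q h : 0 <=: q -> babs (clip q h) <=: q.
Proof.
move=> q0; rewrite babs_le bl_joinP bl_meet_ler /=; apply/andP; split.
  by apply: bl_le_trans (q0); have := bl_leN q0; rewrite oppr0.
by have := bl_leN (bl_le_joinr (bl_meet h q) (- q)); rewrite opprK.
Qed.

Lemma sub_clip_le q h A : 0 <=: A -> babs h <=: A + q -> babs (h - clip q h) <=: A.
Proof.
rewrite !babs_le => A0 /andP[hA NhA]; apply/andP; split.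
  rewrite bl_leBl addrC -bl_leBl; apply: bl_le_trans (bl_le_joinl _ _).
  rewrite bl_meetP !bl_leBl [q + A]addrC hA andbT.
  by have := bl_leD (bl_le_refl h) A0; rewrite addr0.
rewrite opprB bl_leBl bl_joinP; apply/andP; split.
  apply: bl_le_trans (bl_meet_lel _ _) _.
  by have := bl_leD A0 (bl_le_refl h); rewrite add0r.
by rewrite -bl_leBl addrC bl_leBl.
Qed.

Hypothesis HM : M_space X.

Lemma M_space_upper_bound (r : R) (s : seq X) : 0 <= r ->
    (forall x, x \in s -> `|x| <= r) ->
  exists B, [/\ 0 <=: B, forall x, x \in s -> babs x <=: B & `|B| <= r].
Proof.
move=> r0; elim: s => [_|x s IH sr].
  by exists 0; split=> //; rewrite ?normr0// bl_le_refl.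
have [|B [B0 sB Br]] := IH; first by move=> y ys; apply: sr; rewrite inE ys orbT.
exists (bl_join (babs x) B); split.
- by apply: bl_le_trans B0 _; exact: bl_le_joinr.
- move=> y; rewrite inE => /predU1P[->|/sB yB]; first exact: bl_le_joinl.
  by apply: bl_le_trans yB _; exact: bl_le_joinr.
- rewrite HM ?babs_ge0// ge_max Br andbT.
  apply: le_trans (sr x (mem_head _ _)); apply: bl_norm_solid.
  exact: babs_id (babs_ge0 x).
Qed.

(** The sum of the moduli is the supremum of the [2 ^ n] signed sums, each of which
    has norm at most [C].  The vector [b] in the induction carries the signs chosen
    so far. *)
Lemma M_space_sum_abs n (u : {linear 'rV[R]_n -> X}) (C : R) :
    (forall b : 'rV[R]_n, `|b| <= 1 -> `|u b| <= C) ->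
  forall r : seq 'I_n, uniq r ->
  exists B, \sum_(i <- r) babs (u (delta_mx ord0 i)) <=: B /\ `|B| <= C.
Proof.
move=> uC r rU.
suff H (b : 'rV_n) : `|b| <= 1 -> (forall i, i \in r -> b ord0 i = 0) ->
    exists B, [/\ 0 <=: B, babs (u b) + \sum_(i <- r) babs (u (delta_mx ord0 i)) <=: B
      & `|B| <= C].
  have [||B [B0 uB BC]] := H 0; first by rewrite normr0.
    by move=> i _; rewrite mxE.
  exists B; split=> //; apply: bl_le_trans uB.
  by rewrite -[X in X <=: _]add0r; apply: bl_leD (babs_ge0 _) (bl_le_refl _).
elim: r rU b => [_ b b1 _|i r IH /= /andP[ir rU] b b1 b0].
  exists (babs (u b)); split; first exact: babs_ge0.
    by rewrite big_nil addr0 bl_le_refl.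
  by apply: le_trans (uC _ b1); apply: bl_norm_solid; exact: babs_id (babs_ge0 _).
have step (c : R) : `|c| = 1 -> `|b + c *: delta_mx ord0 i| <= 1 /\
    forall j, j \in r -> (b + c *: delta_mx ord0 i) ord0 j = 0.
  move=> c1; split; last first.
    move=> j jr; rewrite !mxE b0 ?inE ?jr ?orbT//.
    by rewrite [_ == i](_ : _ = false) ?mulr0 ?addr0 ?andbF//; apply: contraNF ir => /eqP <-.
  apply: rv_norm_le => // j; rewrite !mxE.
  have [->|ji] := eqVneq j i; first by rewrite b0 ?mem_head// add0r mulr1 c1.
  by rewrite mulr0 addr0; exact: le_trans (rv_norm_ge _ _) b1.
have [p1 p2] := step 1 (normr1 _).
have [m1 m2] := step (-1) (normrN1 _).
have [B [B0 uB BC]] := IH rU _ p1 p2.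
have [B' [B'0 uB' B'C]] := IH rU _ m1 m2.
exists (bl_join B B'); split.
- exact: bl_le_trans B0 (bl_le_joinl _ _).
- rewrite big_cons addrA -bl_leBr; apply: babsD_le; rewrite bl_leBr.
    apply: bl_le_trans (bl_le_joinl _ _); apply: bl_le_trans uB.
    by rewrite linearD scale1r bl_le_refl.
  apply: bl_le_trans (bl_le_joinr _ _); apply: bl_le_trans uB'.
  by rewrite linearD scaleN1r linearN bl_le_refl.
- by rewrite HM// ge_max BC.
Qed.

End VectorLattice.

(** * Norming functionals and coordinate functionals *)

Lemma norming_functional (R : realType) (Z : normedModType R) (z : Z) :
  exists l : {linear Z -> R^o}, (forall x, `|l x| <= `|x|) /\ l z = `|z|.
Proof.
pose G : set (Z * R) := [set p | exists t : R, p = (t *: z, t * `|z|)].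
have lG : linear_graph G.
  move=> c _ _ [t ->] [t' ->]; exists (c * t + t') => /=.
  by rewrite scalerA -scalerDl mulrA -mulrDl.
have dG : dominated_graph 1 G.
  by move=> _ [t ->] /=; rewrite mul1r normrZ ler_wpM2r// ler_norm.
have Gz : G (z, `|z|) by exists 1; rewrite scale1r mul1r.
have [|phi [phi1 phiG]] := hahn_banach (@ler01 R) _ lG dG.
  by exists (z, `|z|).
exists phi; split; last exact: (phiG _ Gz).
by move=> x; rewrite -[`|x|]mul1r.
Qed.

Section GurariiVectors.
Variables (R : realType) (Z : completeNormedModType R) (GZ : gurarii Z).
Variables (s : seq Z) (l : {linear Z -> R^o}) (eps : R).
Hypotheses (l_le : forall x, `|l x| <= `|x|) (eps0 : 0 < eps).

Lemma gurarii_vector : exists v : Z, forall e (c : R), lspan s e ->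
  (1 + eps)^-1 * `|(l e : R) + c| <= `|e + c *: v| /\
  `|e + c *: v| <= (1 + eps) * Num.max `|e| `|(l e : R) + c|.
Proof.
have [u uP] := gurarii_extension s 1 l_le GZ eps0.
exists (u (const_mx 1)) => e c se.
have cE : `|const_mx (l e : R) + c *: const_mx 1 : 'rV[R]_1| = `|(l e : R) + c|.
  apply/eqP; rewrite eq_le; apply/andP; split.
    by apply: rv_norm_le => // i; rewrite !mxE mulr1.
  have := rv_norm_ge (const_mx (l e : R) + c *: const_mx 1 : 'rV[R]_1) ord0.
  by rewrite !mxE mulr1.
have [h1 h2] := uP e (c *: const_mx 1) se; move: h1 h2; rewrite linearZ cE => h1 h2.
split=> //; apply: le_trans h1; rewrite ler_pM2l ?invr_gt0 ?addr_gt0//.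
by rewrite le_max lexx orbT.
Qed.

(** The functional that reads the [j]-th of the coordinates adjoined by
    [gurarii_extension]; it restricts to [l] on the span of [s], because the
    coordinates of [e] are all equal to [l e]. *)
Lemma gurarii_coordinates n (u : {linear 'rV[R]_n -> Z}) (j : 'I_n) :
    (forall e a, lspan s e ->
       (1 + eps)^-1 * Num.max `|e| `|const_mx (l e : R) + a| <= `|e + u a|) ->
  exists phi : {linear Z -> R^o}, (forall x, `|phi x| <= (1 + eps) * `|x|) /\
    (forall e a, lspan s e -> phi (e + u a) = (l e : R) + a ord0 j).
Proof.
move=> uP.
have e1 : 0 < 1 + eps by rewrite addr_gt0.
pose G : set (Z * R) :=
  [set p | exists e a, lspan s e /\ p = (e + u a, (l e : R) + a ord0 j)].
have lG : linear_graph G.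
  move=> c _ _ [e [a [se ->]]] [e' [a' [se' ->]]].
  exists (c *: e + e'), (c *: a + a'); split; first exact: lspan_lin.
  have -> : u (c *: a + a') = c *: u a + u a' by exact: linearP.
  have -> : (l (c *: e + e') : R) = c * (l e : R) + l e' by exact: linearP.
  by rewrite !mxE /= scalerDr mulrDr; congr pair; rewrite addrACA.
have dG : dominated_graph (1 + eps) G.
  move=> _ [e [a [se ->]]] /=; rewrite -ler_pdivrMl//.
  apply: le_trans (uP e a se); rewrite ler_pM2l ?invr_gt0// le_max.
  apply/orP; right; apply: le_trans (ler_norm _) _.
  by have := rv_norm_ge (const_mx (l e : R) + a) j; rewrite !mxE.
have [||phi [phiC phiG]] := hahn_banach _ _ lG dG.
- exact: ltW.
- by exists (0 + u 0, (l 0 : R) + 0); exists 0, 0; split; rewrite ?mxE//; exact: lspan0.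
exists phi; split=> // e a se.
by apply: (phiG (e + u a, (l e : R) + a ord0 j)); exists e, a.
Qed.

End GurariiVectors.

(** Averaging over all pairs: the off-diagonal entries sum to at most
    [n.+1 * K], and there are [n.+1 * n] of them. *)
Lemma small_pair (R : realType) n (a : 'I_n.+1 -> 'I_n.+1 -> R) (K d : R) :
    (forall j, \sum_(i < n.+1 | i != j) a j i <= K) -> K < n%:R * d ->
  exists i j, i != j /\ a i j + a j i <= 2 * d.
Proof.
move=> aK Kd; apply: contrapT => /forallNP H.
have big_pair i j : i != j -> 2 * d < a i j + a j i.
  by move=> ij; rewrite ltNge; apply/negP => ad; apply: (H i); exists j.
pose S := \sum_(j < n.+1) \sum_(i < n.+1 | i != j) a j i.
have SK : S <= n.+1%:R * K.
  apply: le_trans (ler_sum _ (fun j _ => aK j)) _.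
  by rewrite sumr_const card_ord [n.+1%:R * _]mulr_natl.
have S2 : S = \sum_(j < n.+1) \sum_(i < n.+1 | i != j) a i j.
  rewrite /S (exchange_big_dep predT)//=; apply: eq_bigr => i _.
  by apply: eq_bigl => j; rewrite eq_sym.
have : n.+1%:R * (n%:R * (2 * d)) <= S + S.
  rewrite {2}S2 -big_split /=.
  have -> : n.+1%:R * (n%:R * (2 * d)) = \sum_(j < n.+1) \sum_(i < n.+1 | i != j) 2 * d.
    rewrite (eq_bigr (fun=> n%:R * (2 * d))); last first.
      by move=> j _; rewrite sumr_const cardC1 card_ord [n%:R * _]mulr_natl.
    by rewrite sumr_const card_ord [n.+1%:R * _]mulr_natl.
  apply: ler_sum => j _; rewrite -big_split; apply: ler_sum => i ij /=.
  by rewrite ltW// addrC big_pair.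
have : n.+1%:R * K < n.+1%:R * (n%:R * d) by rewrite ltr_pM2l.
by lra.
Qed.

(** * Elements dominated by the unit ball of a subspace *)

Section Hull.
Variables (R : realType) (X : banachLatticeType R) (Z : completeNormedModType R).
Variable i : {linear Z -> X}.
Hypotheses (HM : M_space X) (iN : forall z, `|i z| = `|z|).

(** Domination by the supremum of the moduli of the [i e], expressed through upper
    bounds so that no finite suprema have to be formed. *)
Definition dominated_by (s : seq Z) (h : X) : Prop :=
  forall B, (forall e, e \in s -> bl_le (babs (i e)) B) -> bl_le (babs h) B.

Definition hull (r : R) (h : X) : Prop :=
  exists s : seq Z, (forall e, e \in s -> `|e| <= r) /\ dominated_by s h.

(** In an M-space a finite supremum of moduli of elements of norm at most [r] has norm
    at most [r]. *)
Lemma hull_norm (r : R) h : 0 <= r -> hull r h -> `|h| <= r.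
Proof.
move=> r0 [s [sr sh]].
have [|B [_ sB Br]] := M_space_upper_bound HM (s := [seq i e | e <- s]) r0.
  by move=> _ /mapP[e es ->]; rewrite iN; exact: sr.
apply: le_trans Br; apply: norm_babs_le; apply: sh => e es.
by apply: sB; exact: map_f.
Qed.

Lemma hull_scale (r : R) h : 0 < r -> hull r h -> hull 1 (r^-1 *: h).
Proof.
move=> r0 [s [sr sh]]; exists [seq r^-1 *: e | e <- s]; split.
  move=> _ /mapP[e es ->].
  by rewrite normrZ gtr0_norm ?invr_gt0// mulrC ler_pdivrMr// mul1r sr.
have rV0 : 0 <= r^-1 by rewrite invr_ge0 ltW.
have absr (x : X) B : bl_le (babs (r^-1 *: x)) B = bl_le (babs x) (r *: B).
  have r0' : 0 <= r := ltW r0.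
  rewrite !babs_le; apply/andP/andP => -[h1 h2]; split.
  - by have := bl_leZ2l _ _ _ r0' h1; rewrite scalerA mulfV ?gt_eqF// scale1r.
  - by have := bl_leZ2l _ _ _ r0' h2; rewrite scalerN scalerA mulfV ?gt_eqF// scale1r.
  - by have := bl_leZ2l _ _ _ rV0 h1; rewrite scalerA mulVf ?gt_eqF// scale1r.
  - by have := bl_leZ2l _ _ _ rV0 h2; rewrite scalerN scalerA mulVf ?gt_eqF// scale1r.
move=> B sB; rewrite absr; apply: sh => e es.
by rewrite -absr -linearZ; apply: sB; exact: map_f.
Qed.

Definition cut (u1 u2 : Z) : X :=
  bl_meet (2 *: babs (i u1)) (2 *: babs (i u2)).

Lemma cut_ge0 (u1 u2 : Z) : bl_le 0 (cut u1 u2).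
Proof.
have h v : bl_le 0 (2 *: babs (i v)).
  by have := bl_leZ2l _ _ _ (ler0n R 2) (babs_ge0 (i v)); rewrite scaler0.
by rewrite /cut bl_meetP !h.
Qed.

(** The key estimate.  Writing [e'] for [e - 2 l(e) w], with [w] one of [u1], [u2], the
    hypothesis says that [|e'| + |v|] stays in the hull of radius [r], while
    [|e| <= |e'| + 2 |w|].  Hence [|h| + |v|] exceeds the hull by at most twice the
    minimum of [|u1|] and [|u2|], and thresholding [h] at that level removes the
    excess. *)
Lemma hull_reflect (s : seq Z) (l : {linear Z -> R^o}) (u1 u2 v : Z) h (r : R) :
    dominated_by s h -> (forall e, e \in s -> `|l e| <= 1) ->
    (forall e w : Z, e \in 0 :: s -> w \in [:: u1; u2] ->
       `|e - (2 * (l e : R)) *: w + v| <= r /\ `|e - (2 * (l e : R)) *: w - v| <= r) ->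
  hull r (h - clip (cut u1 u2) h + i v).
Proof.
move=> sh sl sr.
pose re e w := e - (2 * (l e : R)) *: w.
exists ([seq re p.1 p.2 + v | p <- [seq (e, w) | e <- 0 :: s, w <- [:: u1; u2]]] ++
  [seq re p.1 p.2 - v | p <- [seq (e, w) | e <- 0 :: s, w <- [:: u1; u2]]]).
split.
  by move=> e; rewrite mem_cat => /orP[] /mapP[p /allpairsP[[a b] [/= sa ub ->]] ->] /=;
    have [] := sr a b sa ub.
move=> B tB.
have refB e w : e \in 0 :: s -> w \in [:: u1; u2] ->
    bl_le (babs (i (re e w))) (B - babs (i v)).
  move=> es ew; rewrite bl_leBr; apply: babsD_le.
    rewrite -linearD; apply: tB; rewrite mem_cat; apply/orP; left.
    by apply/mapP; exists (e, w) => //; apply/allpairsP; exists (e, w).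
  rewrite -linearB; apply: tB; rewrite mem_cat; apply/orP; right.
  by apply/mapP; exists (e, w) => //; apply/allpairsP; exists (e, w).
(* The vector [0] was added to [s] to make this available even for empty [s]. *)
have A0 : bl_le 0 (B - babs (i v)).
  exact: bl_le_trans (babs_ge0 _) (refB 0 u1 (mem_head _ _) (mem_head _ _)).
apply: bl_le_trans (babsD _ _) _; rewrite -bl_leBr; apply: sub_clip_le => //.
apply: sh => e es.
have eB w : w \in [:: u1; u2] ->
    bl_le (babs (i e)) (B - babs (i v) + 2 *: babs (i w)).
  move=> ew.
  have -> : i e = i (re e w) + (2 * (l e : R)) *: i w.
    by rewrite /re linearB linearZ subrK.
  apply: bl_le_trans (babsD _ _) _; apply: bl_leD.
    by apply: refB => //; rewrite inE es orbT.
  apply: babsZ_le; rewrite normrM gtr0_norm// ger_pMr//; exact: sl.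
rewrite addrC -bl_leBl bl_meetP !bl_leBl ![_ *: _ + _]addrC !eB//.
- by rewrite !inE eqxx orbT.
- exact: mem_head.
Qed.

(** All these truncations are dominated by [2 |u_k|], and the sum of the [|u_k|] has the
    norm of a signed sum.  So a functional cannot be large on many of them at once. *)
Lemma sum_clip_le n (u : {linear 'rV[R]_n -> Z}) (C : R) h (j : 'I_n) :
    (forall b : 'rV[R]_n, `|b| <= 1 -> `|u b| <= C) ->
  `|\sum_(k < n | k != j)
      clip (cut (u (delta_mx ord0 k)) (u (delta_mx ord0 j))) h| <= 2 * C.
Proof.
move=> uC.
pose iu : {linear 'rV[R]_n -> X} := i \o u.
have iuC (b : 'rV[R]_n) : `|b| <= 1 -> `|iu b| <= C by move=> b1; rewrite iN; exact: uC.
have [B [uB BC]] := M_space_sum_abs HM iuC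
  (filter_uniq (fun k => k != j) (index_enum_uniq 'I_n)).
apply: (@le_trans _ _ `|2 *: B|); last by rewrite normrZ gtr0_norm// ler_pM2l.
apply: norm_babs_le; apply: bl_le_trans (babs_sum _ _ _) _.
have := bl_leZ2l _ _ _ (ler0n R 2) uB; apply: bl_le_trans.
rewrite big_filter scaler_sumr; apply: bl_le_sum => k _.
exact: bl_le_trans (clip_le _ (cut_ge0 _ _)) (bl_meet_lel _ _).
Qed.

End Hull.

(** * Retracts of M-spaces are not Gurarii *)

(** The number [lam] is the norm of [Q] with respect to the gauge of the hull; it is
    finite because the hull is norm bounded. *)
Lemma hull_operator_norm (R : realType) (X : banachLatticeType R)
    (Z : completeNormedModType R) (i : {linear Z -> X}) (Q : {linear X -> Z})
    (K : R) :
    M_space X -> (forall z, `|i z| = `|z|) ->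
    0 <= K -> (forall x, `|Q x| <= K * `|x|) ->
  exists lam : R, [/\ 0 <= lam,
    forall r h, 0 < r -> hull i r h -> `|Q h| <= lam * r &
    forall d, 0 < d -> exists h, hull i 1 h /\ lam - d < `|Q h|].
Proof.
move=> HM iN K0 QK.
pose S := [set `|Q h| | h in hull i 1].
have hull0 : hull i 1 0.
  exists [:: 0]; split; first by move=> e; rewrite inE => /eqP ->; rewrite normr0.
  by move=> B /(_ 0 (mem_head _ _)); rewrite linear0.
have S0 : S !=set0 by exists `|Q 0|, 0.
have Sub : has_ubound S.
  exists K => _ [h hh <-]; apply: le_trans (QK h) _.
  exact: ler_piMr K0 (hull_norm HM iN ler01 hh).
exists (sup S); split=> [|r h r0 /(hull_scale r0) hh|d d0].
- apply: (@le_trans _ _ `|Q 0|) => //.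
  by apply: ub_le_sup => //; exists 0.
- rewrite -ler_pdivrMr// mulrC.
  rewrite -[r^-1]gtr0_norm ?invr_gt0// -normrZ -linearZ.
  by apply: ub_le_sup => //; exists (r^-1 *: h).
- have [|_ [h hh <-] Qh] := @sup_gt _ S (sup S - d) S0; last by exists h.
  by rewrite ltrBlDr ltrDl.
Qed.

Theorem gurarii_not_retract_of_M_space (R : realType) (X : banachLatticeType R)
    (Z : completeNormedModType R) (i : {linear Z -> X}) (Q : {linear X -> Z})
    (L : R) :
    M_space X -> gurarii Z -> (forall z, `|i z| = `|z|) ->
    (forall x, `|Q x| <= L * `|x|) -> (forall z, Q (i z) = z) -> False.
Proof.
move=> HM GZ iN QL0 Qi.
have [K [K0 QL]] : exists K, 0 <= K /\ forall x, `|Q x| <= K * `|x|.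
  exists `|L|; split=> // x.
  by apply: le_trans (QL0 x) _; rewrite ler_wpM2r// ler_norm.
have [lam [lam0 lamP lamS]] := hull_operator_norm HM iN K0 QL.
(* At the end [lam + 3/4 <= (1 + eps)^4 * lam] is refuted; since [eps <= 1] the right
   side is at most [lam + 15 * eps * lam], and [eps * lam <= 1/30]. *)
have [eps [eps0 epsE]] : exists eps : R, 0 < eps /\ eps * (30 * (lam + 1)) = 1.
  have lam30 : 0 < 30 * (lam + 1) by rewrite mulr_gt0// ltr_wpDl.
  by exists (30 * (lam + 1))^-1; rewrite invr_gt0 mulVf// gt_eqF.
have [h [hh Qh]] := lamS 8^-1 ltac:(by rewrite invr_gt0).
have [s [s1 sh]] := hh.
pose z := Q h.
have [l [l1 lz]] := norming_functional z.
(* [8 * K] bounds the sum over [k] of the [phi j (Q (g k j))] below. *)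
have [n nK] : exists n : nat, 8 * K < n%:R * 8^-1.
  exists (Num.bound (8 * K * 8)); rewrite -ltr_pdivrMr ?invr_gt0// invrK.
  by apply: archi_boundP; rewrite !mulr_ge0.
have [u uP] := gurarii_extension (z :: s) n.+1 l1 GZ eps0.
have e1 : 0 < 1 + eps by rewrite addr_gt0.
have eps1 : eps <= 1 by nra.
have uC (b : 'rV[R]_n.+1) : `|b| <= 1 -> `|u b| <= 1 + eps.
  move=> b1; have [_] := uP 0 b (lspan0 _).
  rewrite add0r linear0 normr0 (_ : const_mx _ = 0) ?add0r; last first.
    by apply/rowP => j; rewrite !mxE.
  by move/le_trans; apply; rewrite ger_pMr// ge_max ler01.
have phiP j := gurarii_coordinates eps0 j (fun e a se => (uP e a se).1).
pose phi j := projT1 (cid (phiP j)).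
have phiC j x : `|phi j x| <= (1 + eps) * `|x| by have [] := projT2 (cid (phiP j)).
have phiD j e a : lspan (z :: s) e -> phi j (e + u a) = (l e : R) + a ord0 j.
  by have [_] := projT2 (cid (phiP j)); exact.
have phiE j e : lspan (z :: s) e -> phi j e = l e.
  by move=> se; have := phiD j e 0 se; rewrite linear0 mxE !addr0.
pose w k := u (delta_mx ord0 k).
pose g k j := clip (cut i (w k) (w j)) h.
have gC k j : g k j = g j k by rewrite /g /cut bl_meetC.
have [j | p [q [pq small]]] := @small_pair R n (fun j k => phi j (Q (g k j))) _ _ _ nK.
  rewrite (_ : \sum_(_ < _ | _) _ = phi j (Q (\sum_(k < n.+1 | k != j) g k j))).
    apply: le_trans (ler_norm _) _; apply: le_trans (phiC _ _) _.
    have := QL (\sum_(k < n.+1 | k != j) g k j).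
    have := sum_clip_le HM iN h j uC; rewrite -/w -/g.
    set x := `|Q _|; set y := `| _ |; move=> xy yx.
    have Ky : K * y <= K * 4.
      by apply: ler_wpM2l => //; apply: le_trans xy _; lra.
    apply: (@le_trans _ _ (2 * x)); last by lra.
    by apply: ler_wpM2r; [exact: normr_ge0|lra].
  by rewrite !linear_sum.
(* From here on [h] is replaced by [h - G]; by the choice of [p] and [q] this lowers
   the mean of [phi p (Q h)] and [phi q (Q h)] by at most [1/8]. *)
pose G := g p q.
(* The mean of [phi p] and [phi q], divided by [1 + eps] to have norm at most 1. *)
pose l2f (x : Z) : R^o := (2 * (1 + eps))^-1 * ((phi p x : R) + phi q x).
have l2_lin : linear l2f.
  move=> c x y; rewrite /l2f !linearP /= /GRing.scale /=; ring.
pose l2 : {linear Z -> R^o} := HB.pack l2f (GRing.isLinear.Build _ _ _ _ _ l2_lin).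
have l2E x : (l2 x : R) * (2 * (1 + eps)) = (phi p x : R) + phi q x.
  by rewrite mulrC mulrA mulfV ?mul1r// gt_eqF// mulr_gt0.
have l2_le x : `|l2 x| <= `|x|.
  rewrite -(ler_pM2r (x := 2 * (1 + eps))) ?mulr_gt0//.
  rewrite -[X in _ * X <= _]gtr0_norm ?mulr_gt0// -normrM l2E.
  apply: le_trans (ler_normD _ _) _.
  apply: le_trans (lerD (phiC p x) (phiC q x)) _; lra.
pose s2 := [:: w p, w q, Q G, z & s].
have [v vP] := gurarii_vector GZ s2 l2_le eps0.
have s2E e : lspan (z :: s) e -> lspan s2 e.
  by move=> se; do 3 (exists 0; rewrite scale0r subr0).
have hv : hull i ((1 + eps) ^+ 2) (h - G + i v).
  apply: (hull_reflect (l := l) sh) => [e es|e x e0s xw].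
    exact: le_trans (l1 e) (s1 e es).
  have [e_le se] : `|e| <= 1 /\ lspan (z :: s) e.
    move: e0s; rewrite inE => /predU1P[->|es].
      by rewrite normr0; split; [exact: ler01|exact: lspan0].
    by split; [exact: (s1 e es)|apply: lspan_mem; rewrite inE es orbT].
  have le1 : `|(l e : R)| <= 1 := le_trans (l1 e) e_le.
  have [k xk kpq] : exists2 k, x = w k & (p == k)%:R + (q == k)%:R = 1 :> R.
    move: xw; rewrite !inE => /orP[]/eqP->; [exists p|exists q] => //.
      by rewrite eqxx eq_sym (negbTE pq) addr0.
    by rewrite eqxx (negbTE pq) add0r.
  set c : R := 2 * (l e : R).
  have eE : e - c *: x = e + u (- c *: delta_mx ord0 k).
    have -> : u (- c *: delta_mx ord0 k) = - c *: w k by exact: linearZ.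
    by rewrite scaleNr xk.
  have e'1 : `|e - c *: x| <= 1 + eps.
    rewrite eE; apply: le_trans (uP _ _ se).2 _; rewrite ger_pMr// ge_max e_le /=.
    apply: rv_norm_le => // j; rewrite !mxE.
    have [_|_] := eqVneq j k; last by rewrite mulr0 addr0.
    by rewrite mulr1 /c mulr_natl mulr2n opprD addrA subrr sub0r normrN.
  (* The mean of [phi p] and [phi q] takes the value [1/2] at [x], whence the factor 2
     in the reflection. *)
  have l20 : (l2 (e - c *: x) : R) = 0.
    have e2 : 2 * (1 + eps) != 0 by rewrite gt_eqF// mulr_gt0.
    apply: (mulIf e2); rewrite mul0r l2E eE !phiD// !mxE /c eqxx /=; nra.
  have s2e' : lspan s2 (e - c *: x).
    rewrite addrC -scaleNr; apply: lspan_lin; last exact: s2E.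
    by apply: lspan_mem; move: xw; rewrite !inE => /orP[]->; rewrite ?orbT.
  have := (vP _ 1 s2e').2; have := (vP _ (-1) s2e').2.
  rewrite l20 !add0r normrN1 normr1 scale1r scaleN1r => h1 h2.
  have m1 : (1 + eps) * Num.max `|e - c *: x| 1 <= (1 + eps) ^+ 2.
    by rewrite expr2 ler_pM2l// ge_max e'1 lerDl ltW.
  by split; [exact: le_trans m1|exact: le_trans m1].
have s2z : lspan s2 (z - Q G).
  rewrite addrC -scaleN1r; apply: lspan_lin; apply: lspan_mem;
    by rewrite !inE eqxx ?orbT.
have := lamP _ _ (exprn_gt0 2 e1) hv.
rewrite linearD linearB Qi -/z => up.
have [low _] := vP _ 1 s2z; move: low; rewrite scale1r => low.
have zE : (l2 (z - Q G) : R) * (2 * (1 + eps)) >= 2 * (lam - 8^-1) - 2 * 8^-1.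
  have sz : lspan (z :: s) z by apply: lspan_mem; exact: mem_head.
  have pE k : (phi k (z - Q G) : R) = `|z| - phi k (Q G).
    have -> : (phi k (z - Q G) : R) = (phi k z : R) - phi k (Q G) by exact: linearB.
    by rewrite phiE// lz.
  rewrite l2E !pE; move: small Qh; rewrite (gC q p) -/G -/z; lra.
move: zE low; set y : R := l2 _ => zE low.
have : (1 + eps)^-1 * (y + 1) <= lam * (1 + eps) ^+ 2.
  apply: le_trans up; apply: le_trans low; rewrite ler_pM2l ?invr_gt0//.
  exact: ler_norm.
rewrite mulrC ler_pdivrMr// -(ler_pM2r e1) => fin.
have t1 : eps * lam <= 30^-1 by nra.
have t0 : 0 <= eps * lam by rewrite mulr_ge0// ltW.
have p4 : lam * (1 + eps) ^+ 2 * (1 + eps) * (1 + eps) <= lam + 15 * (eps * lam).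
  have -> : lam * (1 + eps) ^+ 2 * (1 + eps) * (1 + eps) =
    lam + (eps * lam) * (4 + 6 * eps + 4 * eps ^+ 2 + eps ^+ 3) by ring.
  rewrite lerD2l mulrC ler_wpM2r//.
  have := exprn_ile1 2 (ltW eps0) eps1; have := exprn_ile1 3 (ltW eps0) eps1; lra.
move: zE fin; nra.
Qed.

(** The projection, with codomain restricted to its range, is a bounded left inverse
    of the inclusion. *)
Corollary gurarii_not_complemented_in_M_space (R : realType)
    (X : banachLatticeType R) (Y : closedSubspace X) :
  M_space X -> complemented Y -> ~ gurarii (subspaceType Y).
Proof.
move=> HM [P [[L PL] PP PY]] GY.
have Pmem x : P x \in cspred Y.
  by rewrite /cspred unfold_in inE -PY; exists x.
pose Q0 x : subspaceType Y := SubspaceElt (Pmem x).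
have Q0_lin : linear Q0 by move=> c x y; apply: val_inj; exact: (linearP P).
pose Q : {linear X -> subspaceType Y} :=
  HB.pack Q0 (GRing.isLinear.Build _ _ _ _ _ Q0_lin).
have Qi (y : subspaceType Y) : Q (\val y) = y.
  apply: val_inj => /=; have := inclP y.
  by rewrite /cspred unfold_in inE -PY => -[x _ <-]; exact: PP.
pose i : {linear subspaceType Y -> X} := \val.
have iN y : `|i y| = `|y| by [].
have QL x : `|Q x| <= L * `|x| by exact: PL.
apply: (@gurarii_not_retract_of_M_space R X (subspaceType Y) i Q L HM GY iN QL).
exact: Qi.
Qed.

(** * The Banach lattice of continuous functions *)

Section ContFunLattice.
Variables (R : realType) (K : topologicalType) (cK : compact [set: K]).
Local Notation CK := (contFun R cK).
Implicit Types f g h : CK.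

Let cf_le f g : bool := `[< forall x, cf_val f x <= cf_val g x >].

Let cf_max_subproof f g : (fun x => Num.max (cf_val f x) (cf_val g x)) \in @cf_pred R K.
Proof.
by apply/cf_predP => x; apply: continuous_max; move: x; apply/cf_predP; exact: cf_valP.
Qed.

Let cf_min_subproof f g : (fun x => Num.min (cf_val f x) (cf_val g x)) \in @cf_pred R K.
Proof.
by apply/cf_predP => x; apply: continuous_min; move: x; apply/cf_predP; exact: cf_valP.
Qed.

Let cf_join f g : CK := cf_Sub cK (cf_max_subproof f g).
Let cf_meet f g : CK := cf_Sub cK (cf_min_subproof f g).

Let cf_le_refl : reflexive cf_le.
Proof. by move=> f; apply/asboolP. Qed.

Let cf_le_anti : antisymmetric cf_le.
Proof.
move=> f g /andP[/asboolP fg /asboolP gf]; apply: cf_val_inj; apply/funext => x.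
by apply/eqP; rewrite eq_le fg gf.
Qed.

Let cf_le_trans : transitive cf_le.
Proof.
move=> g f h /asboolP fg /asboolP gh; apply/asboolP => x.
exact: le_trans (fg x) (gh x).
Qed.

Let cf_joinP f g h : cf_le (cf_join f g) h = cf_le f h && cf_le g h.
Proof.
apply/asboolP/andP => [fgh|[/asboolP fh /asboolP gh] x].
  by split; apply/asboolP => x; have := fgh x; rewrite ge_max => /andP[].
by rewrite ge_max fh gh.
Qed.

Let cf_meetP f g h : cf_le h (cf_meet f g) = cf_le h f && cf_le h g.
Proof.
apply/asboolP/andP => [fgh|[/asboolP fh /asboolP gh] x].
  by split; apply/asboolP => x; have := fgh x; rewrite le_min => /andP[].
by rewrite le_min fh gh.
Qed.

Let cf_leD2r h f g : cf_le f g -> cf_le (f + h) (g + h).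
Proof. by move=> /asboolP fg; apply/asboolP => x; exact: lerD (fg x) (lexx _). Qed.

Let cf_leZ2l (a : R) f g : 0 <= a -> cf_le f g -> cf_le (a *: f) (a *: g).
Proof. by move=> a0 /asboolP fg; apply/asboolP => x; exact: ler_wpM2l a0 _ _ (fg x). Qed.

Let cf_norm_solid f g :
  cf_le (cf_join f (- f)) (cf_join g (- g)) -> `|f| <= `|g|.
Proof.
move=> /asboolP fg; rewrite norm_contFun; apply: supnorm_le => [|x].
  exact: supnorm_ge0.
apply: le_trans (supnorm_ge g x).
have maxN (a : R) : Num.max a (- a) = `|a|.
  by have [a0|a0] := ger0P a; [apply: max_l|apply: max_r]; lra.
by rewrite -!maxN; exact: fg.
Qed.

HB.instance Definition _ := @isBanachLattice.Build R CK cf_le cf_join cf_meet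
  cf_le_refl cf_le_anti cf_le_trans cf_joinP cf_meetP cf_leD2r cf_leZ2l cf_norm_solid.

Lemma contFun_M_space : M_space CK.
Proof.
move=> f g /asboolP f0 /asboolP g0; apply/eqP; rewrite eq_le ge_max; apply/andP; split.
  rewrite norm_contFun; apply: supnorm_le => [|x]; first by rewrite le_max supnorm_ge0.
  have fx : `|cf_val f x| <= `|f| := supnorm_ge f x.
  have gx : `|cf_val g x| <= `|g| := supnorm_ge g x.
  rewrite -[cf_val _ x]/(Num.max (cf_val f x) (cf_val g x)).
  by have [_|_] := leP (cf_val f x) (cf_val g x); rewrite le_max ?fx ?gx ?orbT.
have le_join (k : CK) : (k = f) \/ (k = g) -> supnorm k <= supnorm (cf_join f g).
  move=> kfg; apply: supnorm_le => [|x]; first exact: supnorm_ge0.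
  apply: le_trans (supnorm_ge _ x).
  have [f0x g0x] : 0 <= cf_val f x /\ 0 <= cf_val g x := conj (f0 x) (g0 x).
  rewrite -[cf_val (cf_join f g) x]/(Num.max (cf_val f x) (cf_val g x)).
  rewrite [leRHS]ger0_norm ?le_max ?f0x//.
  by case: kfg => ->; rewrite ger0_norm// lexx ?orbT.
by rewrite !le_join; [|right|left].
Qed.

End ContFunLattice.

Theorem corollary3p5 (R : realType) :
  (forall (K : topologicalType) (cK : compact [set: K]), hausdorff_space K ->
     forall Y : closedSubspace (contFun R cK),
       complemented Y -> ~ gurarii (subspaceType Y)) /\
  (forall (X : banachLatticeType R), M_space X ->
     forall Y : closedSubspace X,
       complemented Y -> ~ gurarii (subspaceType Y)).
Proof.
split=> [K cK _ Y YC|X HM Y]; last exact: gurarii_not_complemented_in_M_space.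
exact: gurarii_not_complemented_in_M_space (@contFun_M_space R K cK) YC.
Qed.
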